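(* Let $G$ be a finitely generated nilpotent group with lower central series $G=\gamma_1(G)\unrhd\gamma_2(G)\unrhd\cdots\unrhd\gamma_c(G)\unrhd\gamma_{c+1}(G)=1$. For $1\le i\le j\le c+1$ denote by $H_{ij}$ the quotient group $\gamma_i(G)/\gamma_j(G)$. Then $H_{ij}$ is e-interpretable in $G$, and consequently the Diophantine problem of $H_{ij}$ is reducible to the Diophantine problem of $G$, for all $i\le j$.
   Context: $\gamma_1(G)=G$ and $\gamma_{k+1}(G)=[\gamma_k(G),G]$. The Diophantine problem $\mathcal D(\mathcal A)$ in an algebraic structure $\mathcal A$ is the problem of deciding, given a finite system of equations with constants in $\mathcal A$, whether it has a solution in $\mathcal A$. $\mathcal D(\mathcal A)$ is reducible to $\mathcal D(\mathcal M)$ if there is an algorithm that for any finite system of equations $S$ in $\mathcal A$ computes a finite system of equations $S_{\mathcal M}$ in $\mathcal M$ such that $S$ has a solution in $\mathcal A$ if and only if $S_{\mathcal M}$ has a solution in $\mathcal M$. E-interpretability: a set $D\subseteq M^k$ is e-definable in a structure $\mathcal M$ with universe $M$ if there is a finite system of equations $\Sigma_D(x_1,\dots,x_k,y_1,\dots,y_l)$ in the language of $\mathcal M$, with constants from $\mathcal M$, such that $\mathbf a\in M^k$ belongs to $D$ if and only if $\Sigma_D(\mathbf a,\mathbf y)$ has a solution $\mathbf y$ in $\mathcal M$. A structure $\mathcal A$ is e-interpretable in $\mathcal M$ if there are $k\in\mathbb N$, a subset $D\subseteq M^k$ and a surjection $\phi:D\to\mathcal A$ such that $D$ is e-definable in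 $\mathcal M$, and the preimages under $\phi$ of the graph of every function of the language of $\mathcal A$, of every relation of the language of $\mathcal A$, and of the equality relation on $\mathcal A$ are e-definable in $\mathcal M$. *)

(* Defs.v *)
From Stdlib Require List.
From HB Require Import structures.
From mathcomp Require Import all_boot all_classical.

Set Implicit Arguments.
Unset Strict Implicit.
Unset Printing Implicit Defensive.

Local Open Scope classical_set_scope.
Local Open Scope group_scope.
Local Open Scope quotient_scope.

Record language := Language {
  fsym : finType;
  farity : fsym -> nat;
  rsym : finType;
  rarity : rsym -> nat
}.

Record structure (L : language) := Structure {
  carrier :> Type;
  finterp : forall f : fsym L, ('I_(farity f) -> carrier) -> carrier;
  rinterp : forall r : rsym L, ('I_(rarity r) -> carrier) -> Prop
}.

(** Terms whose constants are named by [C] and whose variables are named by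
    [V]; what the names stand for is only fixed by [teval]. *)
Inductive term (L : language) (C V : Type) : Type :=
| TVar of V
| TCst of C
| TApp (f : fsym L) of ('I_(farity f) -> term L C V).
Arguments TVar {L C V}.
Arguments TCst {L C V}.
Arguments TApp {L C V}.

Fixpoint teval (L : language) (M : structure L) (C V : Type)
    (cst : C -> M) (v : V -> M) (t : term L C V) : M :=
  match t with
  | TVar x => v x
  | TCst c => cst c
  | TApp f args => finterp (fun i => teval cst v (args i))
  end.

Definition system (L : language) (C V : Type) : Type :=
  seq (term L C V * term L C V).

Definition solves (L : language) (M : structure L) (C V : Type)
    (cst : C -> M) (v : V -> M) (S : system L C V) : Prop :=
  List.Forall (fun e => teval cst v e.1 = teval cst v e.2) S.

(** The power M^I is [I -> M] for a finite index type [I].  The constants of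
    the defining system are arbitrary elements of M, its variables are
    x_i (i in I) and y_0, ..., y_(l-1). *)
Definition e_definable (L : language) (M : structure L) (I : finType)
    (D : set (I -> M)) : Prop :=
  exists (l : nat) (S : system L M (I + 'I_l)),
    forall a : I -> M, D a <->
      exists y : 'I_l -> M,
        solves id (fun x => match x with inl i => a i | inr j => y j end) S.

(** The preimage of an n-ary relation on A, as a subset of M^(n * k). *)
Definition preimage_rel (A M : Type) (k : nat) (D : set ('I_k -> M))
    (phi : {x : 'I_k -> M | D x} -> A) (n : nat) (R : set ('I_n -> A)) :
    set ('I_n * 'I_k -> M) :=
  [set u | exists h : forall i : 'I_n, D (fun j => u (i, j)),
             R (fun i => phi (exist _ _ (h i)))].

(** The value is the last coordinate. *)
Definition graph (A : Type) (n : nat) (f : ('I_n -> A) -> A) :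
    set ('I_n.+1 -> A) :=
  [set a | f (fun i => a (lift ord_max i)) = a ord_max].

Definition equality (A : Type) : set ('I_2 -> A) :=
  [set a | a ord0 = a ord_max].

Definition e_interpretable (LA LM : language)
    (A : structure LA) (M : structure LM) : Prop :=
  exists (k : nat) (D : set ('I_k -> M)) (phi : {x : 'I_k -> M | D x} -> A),
    [/\ (forall a : A, exists x, phi x = a),
        e_definable D,
        (forall f : fsym LA,
            e_definable (preimage_rel phi (graph (finterp (s := A) (f := f))))),
        (forall r : rsym LA,
            e_definable (preimage_rel phi (rinterp (s := A) (r := r))))
      & e_definable (preimage_rel phi (@equality A))].

(** The data are binary trees, and the algorithms are the partial recursive
    functions on trees: besides constructors, projections, composition and
    branching there are primitive recursion and an unbounded loop. *)
Inductive tree := Leaf | Node of tree & tree.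

Definition left_subtree t := if t is Node l _ then l else Leaf.
Definition right_subtree t := if t is Node _ r then r else Leaf.

Inductive program :=
| PId
| PLeaf
| PNode of program & program
| PLeft
| PRight
| PComp of program & program
| PIf of program & program & program
| PRec of program & program
| PWhile of program & program.

(** [runs p x y]: on input [x] the program [p] halts with output [y]. *)
Inductive runs : program -> tree -> tree -> Prop :=
| runs_id x : runs PId x x
| runs_leaf x : runs PLeaf x Leaf
| runs_node p q x y z :
    runs p x y -> runs q x z -> runs (PNode p q) x (Node y z)
| runs_left x : runs PLeft x (left_subtree x)
| runs_right x : runs PRight x (right_subtree x)
| runs_comp p q x y z : runs q x y -> runs p y z -> runs (PComp p q) x z
| runs_if_leaf c p q x y :
    runs c x Leaf -> runs q x y -> runs (PIf c p q) x y
| runs_if_node c p q x l r y :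
    runs c x (Node l r) -> runs p x y -> runs (PIf c p q) x y
| runs_rec_leaf b s x y : runs b x y -> runs (PRec b s) (Node Leaf x) y
| runs_rec_node b s l r x yl yr y :
    runs (PRec b s) (Node l x) yl -> runs (PRec b s) (Node r x) yr ->
    runs s (Node (Node l r) (Node x (Node yl yr))) y ->
    runs (PRec b s) (Node (Node l r) x) y
| runs_while_leaf c p x : runs c x Leaf -> runs (PWhile c p) x x
| runs_while_node c p x l r y z :
    runs c x (Node l r) -> runs p x y -> runs (PWhile c p) y z ->
    runs (PWhile c p) x z.

Lemma runs_functional p x y z : runs p x y -> runs p x z -> y = z.
Proof.
move=> xy; elim: xy z => {p x y}; intros;
  match goal with H : runs _ _ ?z |- _ = ?z => inversion H; subst end;
  repeat match goal with
  | IH : forall z, runs ?p ?x z -> ?y = z, K : runs ?p ?x ?w |- _ =>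
      have ? := IH _ K; clear K; subst
  end; by [|congruence].
Qed.

Fixpoint encode_nat (n : nat) : tree :=
  if n is m.+1 then Node Leaf (encode_nat m) else Leaf.

Definition encode_seq (s : seq tree) : tree := foldr Node Leaf s.

Fixpoint encode_term (L : language) (m : nat) (t : term L 'I_m nat) : tree :=
  match t with
  | TVar x => Node (encode_nat 0) (encode_nat x)
  | TCst c => Node (encode_nat 1) (encode_nat c)
  | TApp f args =>
      Node (encode_nat 2)
        (Node (encode_nat (enum_rank f))
           (encode_seq [seq encode_term (args i) | i <- enum 'I_(farity f)]))
  end.

Definition encode_system (L : language) (m : nat) (S : system L 'I_m nat) :
    tree :=
  encode_seq [seq Node (encode_term e.1) (encode_term e.2) | e <- S].

Definition computable (LA LM : language) (m n : nat)
    (F : system LA 'I_m nat -> system LM 'I_n nat) : Prop :=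
  exists p : program, forall S, runs p (encode_system S) (encode_system (F S)).

Definition generates (L : language) (M : structure L) (m : nat)
    (g : 'I_m -> M) : Prop :=
  forall x : M, exists t : term L 'I_m void, teval g (of_void M) t = x.

Definition finitely_generated (L : language) (M : structure L) : Prop :=
  exists (m : nat) (g : 'I_m -> M), generates g.

(** An instance is a finite system whose constants are written as closed terms
    in the names ['I_m] of a finite generating tuple [g] (for groups: as words
    in the generators and their inverses), so that every finite system with
    constants in M has an instance representing it. *)
Definition diophantine_problem (L : language) (M : structure L) (m : nat)
    (g : 'I_m -> M) : set (system L 'I_m nat) :=
  [set S | exists v : nat -> M, solves g v S].

(** Finite generation is what makes the two problems meaningful as algorithmic
    problems; the reduction must exist for every choice of generating tuples. *)
Definition diophantine_reducible (LA LM : language)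
    (A : structure LA) (M : structure LM) : Prop :=
  [/\ finitely_generated A,
      finitely_generated M
    & forall (m n : nat) (g : 'I_m -> A) (h : 'I_n -> M),
        generates g -> generates h ->
        exists F : system LA 'I_m nat -> system LM 'I_n nat,
          computable F /\
          forall S, diophantine_problem g S <-> diophantine_problem h (F S)].

Inductive group_symbol := SMul | SInv | SOne.

Definition ord_of_group_symbol (s : group_symbol) : 'I_3 :=
  match s with SMul => inord 0 | SInv => inord 1 | SOne => inord 2 end.

Definition group_symbol_of_ord (i : 'I_3) : group_symbol :=
  match val i with 0 => SMul | 1 => SInv | _ => SOne end.

Lemma ord_of_group_symbolK : cancel ord_of_group_symbol group_symbol_of_ord.
Proof. by case; rewrite /group_symbol_of_ord /= inordK. Qed.

HB.instance Definition _ := Finite.copy group_symbol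
  (can_type ord_of_group_symbolK).

Definition group_arity (s : group_symbol) : nat :=
  match s with SMul => 2 | SInv => 1 | SOne => 0 end.

Definition group_language : language :=
  @Language group_symbol group_arity void (of_void nat).

Definition group_interp (G : groupType) (s : group_symbol) :
    ('I_(group_arity s) -> G) -> G :=
  match s with
  | SMul => fun a => a ord0 * a ord_max
  | SInv => fun a => (a ord0)^-1
  | SOne => fun _ => 1
  end.

Definition group_structure (G : groupType) : structure group_language :=
  @Structure group_language G (@group_interp G)
    (fun r : void => match r with end).

Definition gen (G : groupType) (A : set G) : set G :=
  smallest (fun S : set G => group_closed [in S]) A.

Definition fg_group (G : groupType) : Prop :=
  exists s : seq G, gen [set` s] = [set: G].

Definition comm_subgroup (G : groupType) (A B : set G) : set G :=
  gen [set z | exists x y, [/\ A x, B y & z = [~ x, y]]].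

(** The numbering starts at gamma 1 = G; gamma 0 = G is a dummy value. *)
Fixpoint gamma (G : groupType) (n : nat) : set G :=
  match n with
  | 0 | 1 => [set: G]
  | k.+1 => comm_subgroup (@gamma G k) [set: G]
  end.
Arguments gamma : clear implicits.

Section SubgroupLemmas.
Variable G : groupType.
Implicit Types (A S : set G).

Lemma group_closedP S :
  group_closed [in S] <->
  [/\ S 1, (forall x y, S x -> S y -> S (x * y)) & (forall x, S x -> S x^-1)].
Proof.
split=> [[S1 SF]|[S1 SM SV]].
  have S1' : S 1 by rewrite inE in S1.
  have SF' x y : S x -> S y -> S (x / y).
    by move=> Sx Sy; apply/set_mem/SF; apply/mem_set.
  have SV x : S x -> S x^-1 by move=> Sx; rewrite -[x^-1]mul1g; apply: SF'.
  by split=> // x y Sx Sy; rewrite -[y]invgK; apply/SF'/SV.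
split; first exact/mem_set.
by move=> x y /set_mem Sx /set_mem Sy; apply/mem_set/SM => //; apply: SV.
Qed.

Lemma group_closed_gen A : group_closed [in gen A].
Proof.
apply/group_closedP; split=> [S [/group_closedP [S1 _ _]]|x y Ax Ay S|x Ax S].
- by [].
- move=> [Sc AS]; have /group_closedP [_ SM _] := Sc.
  by apply: SM; [apply: Ax | apply: Ay].
- by move=> [Sc AS]; have /group_closedP [_ _] := Sc; apply; apply: Ax.
Qed.

Lemma group_closed_gamma n : group_closed [in gamma G n].
Proof.
have T : group_closed [in [set: G]] by apply/group_closedP.
by case: n => [|[|n]] //; apply: group_closed_gen.
Qed.

Lemma gammaJ n x g : gamma G n x -> gamma G n (x ^ g).
Proof.
elim: n x => [|[|n] IH] x // Gx.
have /group_closedP [H1 HM HV] := group_closed_gamma n.+2.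
have sub : gamma G n.+2 `<=` [set y | gamma G n.+2 (y ^ g)].
  apply: smallest_sub => [|z [a [b [Ga _ ->]]]].
    apply/group_closedP; split=> /= [|y z Gy Gz|y Gy].
    - by rewrite conj1g.
    - by rewrite conjMg; apply: HM.
    - by rewrite conjVg; apply: HV.
  rewrite /= conjRg; apply: sub_gen_smallest.
  by exists (a ^ g), (b ^ g); split=> //; apply: IH.
exact: sub.
Qed.

End SubgroupLemmas.

Section LowerCentralQuotient.
Variables (G : groupType) (i j : nat).

Definition gamma_pred : {pred G} := [in gamma G i].

Record gamma_sub := GammaSub { gamma_val : G; _ : gamma_val \in gamma_pred }.

HB.instance Definition _ := [isSub of gamma_sub for gamma_val].
HB.instance Definition _ := [Choice of gamma_sub by <:].
HB.instance Definition _ := SubChoice_isSubGroup.Build G gamma_pred gamma_sub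
  (@group_closed_gamma G i).

(** For i <= j these are the left cosets of gamma_j(G) in gamma_i(G). *)
Definition gamma_eq (x y : gamma_sub) : bool :=
  `[< gamma G j ((val x)^-1 * val y) >].

Lemma gamma_eq_refl : reflexive gamma_eq.
Proof.
have [H1 _ _] := (group_closedP _).1 (@group_closed_gamma G j).
by move=> x; apply/asboolP; rewrite mulVg.
Qed.

Lemma gamma_eq_sym : symmetric gamma_eq.
Proof.
have [_ _ HV] := (group_closedP _).1 (@group_closed_gamma G j).
by move=> x y; apply/asboolP/asboolP => /HV; rewrite invgM invgK.
Qed.

Lemma gamma_eq_trans : transitive gamma_eq.
Proof.
have [_ HM _] := (group_closedP _).1 (@group_closed_gamma G j).
move=> y x z /asboolP xy /asboolP yz; apply/asboolP.
by have := HM _ _ xy yz; rewrite -mulgA mulVKg.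
Qed.

Canonical gamma_equiv :=
  EquivRel gamma_eq gamma_eq_refl gamma_eq_sym gamma_eq_trans.

Definition gamma_quotient := {eq_quot gamma_eq}.

HB.instance Definition _ := Choice.on gamma_quotient.
HB.instance Definition _ := EqQuotient.on gamma_quotient.

Definition gamma_one : gamma_quotient := lift_cst gamma_quotient 1.
Definition gamma_mul := lift_op2 gamma_quotient (fun x y : gamma_sub => x * y).
Definition gamma_inv := lift_op1 gamma_quotient (fun x : gamma_sub => x^-1).

Canonical pi_gamma_one := PiConst gamma_one.

Lemma pi_gamma_mul : {morph \pi : x y / x * y >-> gamma_mul x y}.
Proof.
have [_ HM _] := (group_closedP _).1 (@group_closed_gamma G j).
unlock gamma_mul => x y; apply/eqmodP/asboolP.
case: piP => x' /eqmodP /asboolP xx; case: piP => y' /eqmodP /asboolP yy.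
rewrite !valM; have := HM _ _ (gammaJ (val y) xx) yy.
by rewrite invgM conjgE !mulgA mulgK.
Qed.
Canonical pi_gamma_mul_morph := PiMorph2 pi_gamma_mul.

Lemma pi_gamma_inv : {morph \pi : x / x^-1 >-> gamma_inv x}.
Proof.
have [_ _ HV] := (group_closedP _).1 (@group_closed_gamma G j).
unlock gamma_inv => x; apply/eqmodP/asboolP.
case: piP => x' /eqmodP /asboolP xx.
have := HV _ (gammaJ (val x)^-1 xx).
by rewrite !gmulfV conjgE !invgM !invgK !mulgA mulgK.
Qed.
Canonical pi_gamma_inv_morph := PiMorph1 pi_gamma_inv.

Lemma gamma_mulA : associative gamma_mul.
Proof. by do 3!elim/quotW=> ?; rewrite !piE mulgA. Qed.
Lemma gamma_mul1 : left_id gamma_one gamma_mul.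
Proof. by elim/quotW=> ?; rewrite !piE mul1g. Qed.
Lemma gamma_1mul : right_id gamma_one gamma_mul.
Proof. by elim/quotW=> ?; rewrite !piE mulg1. Qed.
Lemma gamma_mulV : left_inverse gamma_one gamma_inv gamma_mul.
Proof. by elim/quotW=> ?; rewrite !piE mulVg. Qed.
Lemma gamma_Vmul : right_inverse gamma_one gamma_inv gamma_mul.
Proof. by elim/quotW=> ?; rewrite !piE mulgV. Qed.

HB.instance Definition _ := isGroup.Build gamma_quotient
  gamma_mulA gamma_mul1 gamma_1mul gamma_mulV gamma_Vmul.

End LowerCentralQuotient.

(* Main.v *)
Require Import Defs.
From HB Require Import structures.
From mathcomp Require Import all_boot all_classical.

(** Write G = <h_1, ..., h_n>.  Everything rests on the fact that each
    gamma_(k+1)(G) is the set of values of one fixed word with constants in G.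
    Indeed in a nilpotent group every element of gamma_(k+1) is a product
    [x_1, h_1] ... [x_n, h_n] with all x_a in gamma_k, one factor per generator
    ([gammaS_comm_prods]); iterating this down to gamma_1 = G gives a group word
    in n^k variables whose set of values is gamma_(k+1) ([gamma_wordP]).

    The product formula is proved modulo gamma_m, by induction on m.  Modulo
    gamma_(l+2) the commutator map gamma_l x G -> gamma_(l+1) is bilinear with
    central values, so an element of gamma_(l+1) is such a product modulo
    gamma_(l+2) ([gammaS_comm_prods_step]).  If z is already the product of the
    [x_a, h_a] modulo gamma_(l+1), write the error in gamma_(l+1) as the product
    of the [y_a, h_a] with y_a in gamma_l: as [x_a, h_a] lies in gamma_2 and
    gamma_2 commutes with gamma_l modulo gamma_(l+2), the product of the
    [x_a y_a, h_a] is z modulo gamma_(l+2) ([comm_prodsM]).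

    Consequently, the condition that certain elements lie in gamma_i and that a
    term in them lies in gamma_j is a finite system of equations
    ([gamma_definable]).  With the projection gamma_i -> gamma_i / gamma_j this
    interprets the quotient in dimension 1, since an equation between classes
    says that a term in representatives lies in gamma_j.

    The same word gives the reduction of Diophantine problems.  Given a system
    over gamma_i / gamma_j, replace each constant by a word for a representative,
    each variable by the word for gamma_i in fresh variables, and each equation
    l = r by l = r z, where z is the word for gamma_j in variables of its own.
    This is a substitution in terms, computed by a structural recursion on the
    encodings, so the only work is to number the fresh variables in a computable
    way.  Finite generation of the quotient follows from the same bilinearity
    ([gamma_fg]). *)

Set Implicit Arguments.
Unset Strict Implicit.
Unset Printing Implicit Defensive.

Local Open Scope classical_set_scope.
Local Open Scope group_scope.
Local Open Scope quotient_scope.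

Local Arguments gamma : simpl never.

(** * The lower central series and its factor groups *)

Section Subgroups.
Variable G : groupType.
Implicit Types (A S : set G) (x y z : G).

Lemma gen_min A S : group_closed [in S] -> A `<=` S -> gen A `<=` S.
Proof. by move=> Sc; apply: smallest_sub. Qed.

Lemma sub_gen A : A `<=` gen A.
Proof. exact: sub_gen_smallest. Qed.

Lemma gamma1 n : gamma G n 1.
Proof. by have /group_closedP[] := @group_closed_gamma G n. Qed.

Lemma gammaM n x y : gamma G n x -> gamma G n y -> gamma G n (x * y).
Proof. by have /group_closedP[_ + _] := @group_closed_gamma G n; apply. Qed.

Lemma gammaV n x : gamma G n x -> gamma G n x^-1.
Proof. by have /group_closedP[_ _] := @group_closed_gamma G n; apply. Qed.

Lemma gamma_commg n x y : gamma G n x -> gamma G n.+1 [~ x, y].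
Proof.
case: n => [|n] Gx //.
by apply: sub_gen; exists x, y.
Qed.

Lemma gammaS n : gamma G n.+1 `<=` gamma G n.
Proof.
case: n => [|n] //; apply: gen_min (@group_closed_gamma G _) _.
move=> _ [x [y [Gx _ ->]]]; apply: gammaM; first exact: gammaV.
exact: gammaJ.
Qed.

Lemma gamma_anti m n : (m <= n)%N -> gamma G n `<=` gamma G m.
Proof.
elim: n => [|n IH]; first by rewrite leqn0 => /eqP->.
rewrite leq_eqVlt => /orP[/eqP-> //|/IH mn].
exact: subset_trans (@gammaS n) mn.
Qed.

Lemma mem_gamma1 x : x \in gamma_pred 1.
Proof. exact/mem_set. Qed.

(** gamma_1 is all of G, so this is the projection to G / gamma_n. *)
Definition gamma_proj n x : gamma_quotient G 1 n :=
  \pi_(gamma_quotient G 1 n) (GammaSub (mem_gamma1 x)).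

Lemma gamma_projE n x y : gamma_proj n x = gamma_proj n y <-> gamma G n (x^-1 * y).
Proof. by split=> [/eqmodP/asboolP|?]; last apply/eqmodP/asboolP. Qed.

Lemma gamma_projM n : {morph gamma_proj n : x y / x * y}.
Proof.
move=> x y; rewrite /gamma_proj.
have -> : GammaSub (mem_gamma1 (x * y))
        = GammaSub (mem_gamma1 x) * GammaSub (mem_gamma1 y) by apply: val_inj.
exact: pi_gamma_mul.
Qed.
HB.instance Definition _ n :=
  isMultiplicative.Build G (gamma_quotient G 1 n) (gamma_proj n) (@gamma_projM n).

Lemma gamma_proj1 n : gamma_proj n 1 = 1.
Proof. by apply: (mulgI (gamma_proj n 1)); rewrite -gmulfM !mulg1. Qed.
HB.instance Definition _ n :=
  Multiplicative_isUMagmaMorphism.Build G (gamma_quotient G 1 n) (gamma_proj n)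
    (@gamma_proj1 n).

Lemma gamma_projV n : {morph gamma_proj n : x / x^-1}.
Proof. exact: gmulfV. Qed.

Lemma gamma_projR n : {morph gamma_proj n : x y / [~ x, y]}.
Proof. exact: gmulfR. Qed.

Lemma gamma_proj_eq1 n x : gamma_proj n x = 1 <-> gamma G n x.
Proof.
rewrite -(gamma_proj1 n); split=> [/esym/gamma_projE|Gx].
  by rewrite invg1 mul1g.
by apply/esym/gamma_projE; rewrite invg1 mul1g.
Qed.

Lemma gamma_proj_surj n (q : gamma_quotient G 1 n) : exists x, gamma_proj n x = q.
Proof.
elim/quotW: q => x; exists (val x); congr (\pi _); exact: val_inj.
Qed.

End Subgroups.

(** * Commutators with central values *)

Section CommutatorCalculus.
Variable G : groupType.
Implicit Types x y z u v : G.

Lemma commMg x y z : [~ x * y, z] = [~ x, z] ^ y * [~ y, z].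
Proof. by rewrite !commgEl !conjgE !gnorm. Qed.

Lemma commgM x y z : [~ x, y * z] = [~ x, z] * [~ x, y] ^ z.
Proof. by rewrite !commgEl !conjgE !gnorm. Qed.

Lemma commMg_commute x y z :
  commute [~ x, z] y -> [~ x * y, z] = [~ x, z] * [~ y, z].
Proof. by move=> /commgP/conjg_fixP cy; rewrite commMg cy. Qed.

Lemma mulgMACA x y z u : commute y z -> x * y * (z * u) = x * z * (y * u).
Proof. by move=> yz; rewrite -!mulgA (mulgA y) yz -mulgA. Qed.

Definition central z := forall u, commute z u.

Lemma commgM_central x y z : central [~ x, y] ->
  [~ x, y * z] = [~ x, y] * [~ x, z].
Proof.
move=> cxy; rewrite commgM; have /commgP/conjg_fixP-> := cxy z.
by rewrite cxy.
Qed.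

Lemma commVg_central x y : central [~ x, y] -> [~ x^-1, y] = [~ x, y]^-1.
Proof.
move=> cxy; apply/esym/mulg1_eq; rewrite -commMg_commute ?mulgV ?comm1g //.
Qed.

Lemma commgV_central x y : central [~ x, y] -> [~ x, y^-1] = [~ x, y]^-1.
Proof.
by move=> cxy; apply/esym/mulg1_eq; rewrite -commgM_central // mulgV commg1.
Qed.

(** The map that sends u to the commutator of y and u is a morphism to an abelian
    group, hence it kills commutators. *)
Lemma commute_commg y : (forall u, central [~ y, u]) ->
  forall u v, commute y [~ u, v].
Proof.
move=> cy u v; apply/commgP/eqP; apply: (mulgI [~ y, v * u]).
by rewrite -commgM_central // -commgC mulg1 !commgM_central // cy.
Qed.

End CommutatorCalculus.

(** * Elements of the lower central series as short products of commutators *)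

Section Width.
Variable G : groupType.
Implicit Types (x y z w : G) (s : seq G) (k l m n : nat).

Lemma gamma_proj_central n z : gamma G n z -> central (gamma_proj n.+1 z).
Proof.
move=> Gz u; have [x <-] := gamma_proj_surj u.
by apply/commgP/eqP; rewrite -gamma_projR; apply/gamma_proj_eq1/gamma_commg.
Qed.

Lemma gamma_proj_commg_central n x y :
  gamma G n x -> central [~ gamma_proj n.+2 x, gamma_proj n.+2 y].
Proof.
by move=> Gx; rewrite -gamma_projR; apply/gamma_proj_central/gamma_commg.
Qed.

(** Commutators of gamma_n and gamma_2 lie in gamma_(n+2).  As gamma_2 is generated
    by commutators of arbitrary elements, [commute_commg] gives this directly,
    without the three subgroups lemma. *)
Lemma gamma_proj_commute n x y : gamma G n y -> gamma G 2 x ->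
  commute (gamma_proj n.+2 y) (gamma_proj n.+2 x).
Proof.
move=> Gy; suff : gamma G 2 `<=`
    [set x | commute (gamma_proj n.+2 y) (gamma_proj n.+2 x)] by exact.
apply: gen_min => [|_ [a [b [_ _ ->]]] /=].
  apply/group_closedP; split=> /= [|a b ca cb|a ca].
  - by rewrite gamma_proj1; apply: commute1.
  - by rewrite gamma_projM; apply: commuteM.
  - by rewrite gamma_projV; apply: commuteV.
rewrite gamma_projR; apply: commute_commg => u.
by have [v <-] := gamma_proj_surj u; apply: gamma_proj_commg_central.
Qed.

(** Exactly one factor per entry of s, in the order of s: the number of factors
    does not depend on the element, which is what makes it a single word. *)
Fixpoint comm_prods (A : set G) s : set G :=
  if s is g :: s' then
    [set z | exists x w, [/\ A x, comm_prods A s' w & z = [~ x, g] * w]]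
  else [set 1].

Lemma comm_prods_gamma k s w : comm_prods (gamma G k) s w -> gamma G k.+1 w.
Proof.
elim: s w => [|g s IH] w /=; first by move=> ->; apply: gamma1.
by move=> [x [v [Gx /IH Gv ->]]]; apply: gammaM Gv; apply: gamma_commg.
Qed.

Lemma comm_prods1 (A : set G) s : A 1 -> comm_prods A s 1.
Proof.
by move=> A1; elim: s => //= g s IH; exists 1, 1; split; rewrite // comm1g mul1g.
Qed.

Lemma comm_prods_commg k s g x : gamma G k x -> g \in s ->
  comm_prods (gamma G k) s [~ x, g].
Proof.
move=> Gx; elim: s => //= g' s IH; rewrite inE => /predU1P[->|gs].
  by exists x, 1; split=> //; rewrite ?mulg1 //; apply/comm_prods1/gamma1.
by exists 1, [~ x, g]; split; rewrite ?comm1g ?mul1g //; [apply: gamma1|apply: IH].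
Qed.

(** The product of the [x_a, g_a] and the [y_a, g_a] is that of the
    [x_a y_a, g_a]: [x_a y_a, g_a] = [x_a, g_a]^(y_a) [y_a, g_a], where y_a commutes
    with gamma_2 modulo gamma_(l+2), and the factors [y_a, g_a] can be moved past
    the others because they are central modulo gamma_(l+2).  The asymmetry k <= l
    lets the second product be a correction to the first. *)
Lemma comm_prodsM k l s w1 w2 : (1 <= k <= l)%N ->
  comm_prods (gamma G k) s w1 -> comm_prods (gamma G l) s w2 ->
  exists2 w3, comm_prods (gamma G k) s w3
            & gamma_proj l.+2 w3 = gamma_proj l.+2 (w1 * w2).
Proof.
move=> /andP[k1 kl]; elim: s w1 w2 => [|g s IH] w1 w2 /=.
  by move=> -> ->; exists 1; rewrite ?mulg1.
move=> [x [v1 [Gx sv1 ->]]] [y [v2 [Gy sv2 ->]]].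
have [v3 sv3 fv3] := IH _ _ sv1 sv2.
exists ([~ x * y, g] * v3).
  by exists (x * y), v3; split=> //; apply: gammaM (gamma_anti kl Gy).
rewrite !(gamma_projR, gamma_projM) fv3 gamma_projM commMg_commute; last first.
  rewrite -gamma_projR; apply/commute_sym/gamma_proj_commute => //.
  exact: (@gamma_anti _ 2 k.+1 k1) (gamma_commg g Gx).
by apply: mulgMACA; apply: gamma_proj_commg_central.
Qed.

Lemma comm_prodsV k s w : comm_prods (gamma G k) s w ->
  exists2 w', comm_prods (gamma G k) s w'
            & gamma_proj k.+2 w' = gamma_proj k.+2 w^-1.
Proof.
elim: s w => [|g s IH] w /=; first by move=> ->; exists 1; rewrite ?invg1.
move=> [x [v [Gx /IH[v' sv' fv'] ->]]]; exists ([~ x^-1, g] * v').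
  by exists x^-1, v'; split=> //; apply: gammaV.
have cxg : central [~ gamma_proj k.+2 x, gamma_proj k.+2 g].
  exact: gamma_proj_commg_central.
rewrite invgM !(gamma_projR, gamma_projM) fv' !gamma_projV gamma_projR.
rewrite commVg_central //.
by apply/commute_sym/commuteV/commute_sym.
Qed.

(** By bilinearity modulo gamma_(k+2), a subgroup containing gamma_(k+2) contains
    gamma_(k+1) as soon as it contains the [x, g] with g in a generating set. *)
Lemma gammaS_sub k s (T : set G) : gen [set` s] = [set: G] ->
  (forall x y, gamma_proj k.+2 x = gamma_proj k.+2 y -> T x -> T y) ->
  group_closed [in T] ->
  (forall x g, gamma G k x -> g \in s -> T [~ x, g]) ->
  (1 <= k)%N -> gamma G k.+1 `<=` T.
Proof.
move=> gs Tf Tc Ts; case: k Tf Ts => // k Tf Ts _.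
have /group_closedP[T1 TM TV] := Tc.
apply: gen_min => // _ [x [u [Gx _ ->]]].
suff : gen [set` s] `<=` [set u | T [~ x, u]].
  by rewrite gs; apply.
apply: gen_min => [|g gs']; last exact: Ts.
apply/group_closedP; split=> /= [|a b Ta Tb|a Ta].
- by rewrite commg1.
- apply: Tf (TM _ _ Ta Tb); rewrite !(gamma_projR, gamma_projM) commgM_central //.
  exact: gamma_proj_commg_central.
- apply: Tf (TV _ Ta); rewrite gamma_projV !gamma_projR gamma_projV commgV_central //.
  exact: gamma_proj_commg_central.
Qed.

Section Generated.
Variables (s : seq G) (gen_s : gen [set` s] = [set: G]).

Lemma gammaS_comm_prods_step k z : (1 <= k)%N -> gamma G k.+1 z ->
  exists2 w, comm_prods (gamma G k) s w & gamma_proj k.+2 z = gamma_proj k.+2 w.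
Proof.
move=> k1; apply: (gammaS_sub gen_s (T := [set z | exists2 w, _ & _])) => //=.
- by move=> x y -> .
- apply/group_closedP; split=> /=.
  + by exists 1 => //; apply/comm_prods1/gamma1.
  + move=> x y [u su fu] [v sv fv]; have [|w sw fw] := comm_prodsM _ su sv.
      by rewrite k1 leqnn.
    by exists w => //; rewrite fw !gamma_projM fu fv.
  + move=> x [u su fu]; have [w sw fw] := comm_prodsV su.
    by exists w => //; rewrite fw !gamma_projV fu.
- by move=> x g Gx gs; exists [~ x, g] => //; apply: comm_prods_commg.
Qed.

(** The inductive step corrects a product that is right modulo gamma_m by one
    that represents the error in gamma_m modulo gamma_(m+1). *)
Lemma gammaS_comm_prods_mod k m z : (1 <= k)%N -> (k < m)%N -> gamma G k.+1 z ->
  exists2 w, comm_prods (gamma G k) s w & gamma_proj m z = gamma_proj m w.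
Proof.
move=> k1; elim: m => // m IH; rewrite ltnS leq_eqVlt => /orP[/eqP<-|km] Gz.
  exists 1; first exact/comm_prods1/gamma1.
  by rewrite gamma_proj1; apply/gamma_proj_eq1.
have [w sw /esym/gamma_projE Gwz] := IH km Gz.
case: m km {IH} Gwz => // m; rewrite ltnS => km Gwz.
have [v sv fv] := gammaS_comm_prods_step (leq_trans k1 km) Gwz.
have [|u su fu] := comm_prodsM _ sw sv; first by rewrite k1.
by exists u => //; rewrite fu gamma_projM -fv -gamma_projM mulVKg.
Qed.

Lemma gammaS_comm_prods c k : gamma G c.+1 = [set 1] -> (1 <= k)%N ->
  gamma G k.+1 = comm_prods (gamma G k) s.
Proof.
move=> Gc k1; apply/seteqP; split=> [z Gz|w]; last exact: comm_prods_gamma.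
have [|w sw /gamma_projE] := gammaS_comm_prods_mod (m := maxn k.+1 c.+1) k1 _ Gz.
  by rewrite leq_maxl.
move/(gamma_anti (leq_maxr _ _)); rewrite Gc => /= zw.
suff -> : z = w by [].
by apply: (mulgI z^-1); rewrite zw mulVg.
Qed.

(** * Finite generation of the lower central series *)

Definition gen_mod n (r : seq G) : set G :=
  [set z | exists2 z', gen [set` r] z' & gamma_proj n z = gamma_proj n z'].

Lemma eq_gen_mod n r x y :
  gamma_proj n x = gamma_proj n y -> gen_mod n r x -> gen_mod n r y.
Proof. by rewrite /gen_mod /= => ->. Qed.

Lemma group_closed_gen_mod n r : group_closed [in gen_mod n r].
Proof.
have /group_closedP[g1 gM gV] := @group_closed_gen G [set` r].
apply/group_closedP; split=> [|x y [u ru fu] [v rv fv]|x [u ru fu]].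
- by exists 1.
- by exists (u * v); [apply: gM|rewrite !gamma_projM fu fv].
- by exists u^-1; [apply: gV|rewrite !gamma_projV fu].
Qed.

(** From generators of gamma_k modulo gamma_(k+1), the commutators with the
    generators of G generate gamma_(k+1) modulo gamma_(k+2). *)
Lemma gamma_fg_mod k : (1 <= k)%N ->
  exists2 r : seq G, [set` r] `<=` gamma G k & gamma G k `<=` gen_mod k.+1 r.
Proof.
elim: k => // k IH _; case: (posnP k) => [->|k1].
  by exists s => // z _; exists z; rewrite // gen_s.
have [r rG rz] := IH k1.
pose r' := [seq [~ x, g] | x <- r, g <- s].
have r'P x g : x \in r -> g \in s -> [~ x, g] \in r'.
  by move=> xr gs; apply: (allpairs_f (fun x g => [~ x, g])).
have r'G : [set` r'] `<=` gamma G k.+1.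
  by move=> _ /allpairsP[[x g] [/rG Gx _ ->]]; apply: gamma_commg.
exists r' => //; apply: (gammaS_sub gen_s) => //.
- exact: eq_gen_mod.
- exact: group_closed_gen_mod.
move=> x g Gx gs; have [x' rx' /esym/gamma_projE Gx'] := rz _ Gx.
have [v xE Gv] : exists2 v, x = x' * v & gamma G k.+1 v.
  by exists (x'^-1 * x); rewrite ?mulVKg.
apply: (@eq_gen_mod _ _ [~ x', g]).
  have cv := gamma_proj_central Gv.
  rewrite xE !(gamma_projR, gamma_projM) commMg_commute.
    by have /commgP/eqP-> := cv (gamma_proj k.+2 g); rewrite mulg1.
  exact/commute_sym/cv.
suff: gen [set` r] `<=` [set y | gamma G k y /\ gen_mod k.+2 r' [~ y, g]].
  by move=> /(_ _ rx')[].
have /group_closedP[T1 TM TV] := group_closed_gen_mod k.+2 r'.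
apply: gen_min => [|a ra] /=; last first.
  by split; [exact: rG|exists [~ a, g] => //; exact: (sub_gen (r'P _ _ ra gs))].
apply/group_closedP; split=> /= [|a b [Ga Ta] [Gb Tb]|a [Ga Ta]].
- by split; [apply: gamma1|rewrite comm1g].
- split; first exact: gammaM.
  apply: eq_gen_mod (TM _ _ Ta Tb); rewrite !(gamma_projR, gamma_projM).
  by rewrite commMg_commute //; apply: gamma_proj_commg_central.
- split; first exact: gammaV.
  apply: eq_gen_mod (TV _ Ta); rewrite gamma_projV !gamma_projR gamma_projV.
  by rewrite commVg_central //; apply: gamma_proj_commg_central.
Qed.

(** Downward induction on k: add generators of gamma_k modulo gamma_(k+1) to
    generators of gamma_(k+1); the induction starts at gamma_(c+1) = 1. *)
Lemma gamma_fg c k : gamma G c.+1 = [set 1] -> (1 <= k)%N ->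
  exists r : seq G, gamma G k = gen [set` r].
Proof.
move=> Gc k1.
suff [r rG Gr] : exists2 r : seq G, [set` r] `<=` gamma G k
    & gamma G k `<=` gen [set` r].
  exists r; apply/seteqP; split=> //; exact: gen_min (@group_closed_gamma G k) rG.
have [d] := ubnP (c.+1 - k); elim: d k k1 => // d IH k k1; rewrite ltnS => kd.
have [ck|kc] := leqP c.+1 k.
  exists [::] => // z /(gamma_anti ck); rewrite Gc => ->.
  by have /group_closedP[] := @group_closed_gen G [set` ([::] : seq G)].
have [r rG Gr] := gamma_fg_mod k1.
have [||r' r'G Gr'] := IH k.+1 => //.
  by rewrite subnS; case: (c.+1 - k)%N (subn_gt0 k c.+1) kd => [|e]; rewrite ?kc.
exists (r ++ r').
  by move=> x /=; rewrite mem_cat => /orP[/rG|/r'G/gammaS].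
have /group_closedP[_ gM _] := @group_closed_gen G [set` r ++ r'].
have mono q : {subset q <= r ++ r'} -> gen [set` q] `<=` gen [set` r ++ r'].
  by move=> qr; apply: gen_min (@group_closed_gen G _) _ => x /qr; apply: sub_gen.
move=> z Gz; have [z' rz' /esym/gamma_projE Gz'] := Gr _ Gz.
rewrite -(mulVKg z' z); apply: gM.
  by apply: mono rz' => x xr; rewrite mem_cat xr.
by apply: mono (Gr' _ Gz') => x xr; rewrite mem_cat xr orbT.
Qed.

End Generated.
End Width.

(** * Substitution in terms *)

Section Terms.
Variable L : language.

Fixpoint tsubst (C C' V V' : Type) (sc : C -> term L C' V')
    (sv : V -> term L C' V') (t : term L C V) : term L C' V' :=
  match t with
  | TVar x => sv x
  | TCst a => sc a
  | TApp f args => TApp f (fun i => tsubst sc sv (args i))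
  end.

Lemma teval_tsubst (M : structure L) (C C' V V' : Type) (cst : C' -> M)
    (v : V' -> M) (sc : C -> term L C' V') (sv : V -> term L C' V')
    (t : term L C V) :
  teval cst v (tsubst sc sv t) = teval (teval cst v \o sc) (teval cst v \o sv) t.
Proof.
by elim: t => //= f args IH; congr finterp; apply/funext => i; apply: IH.
Qed.

Definition rename (C V V' : Type) (r : V -> V') : term L C V -> term L C V' :=
  tsubst TCst (TVar \o r).

Lemma teval_rename (M : structure L) (C V V' : Type) (cst : C -> M) (v : V' -> M)
    (r : V -> V') (t : term L C V) :
  teval cst v (rename r t) = teval cst (v \o r) t.
Proof. exact: teval_tsubst. Qed.

Lemma teval_ext (M : structure L) (C V : Type) (cst : C -> M) (v w : V -> M)
    (t : term L C V) : v =1 w -> teval cst v t = teval cst w t.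
Proof. by move=> /funext->. Qed.

End Terms.

(** * Group words *)

Section GroupTerms.
Notation gterm := (term group_language).

Definition tmul (C V : Type) (t u : gterm C V) : gterm C V :=
  @TApp group_language C V SMul (fun i : 'I_2 => if val i is 0 then t else u).
Definition tinv (C V : Type) (t : gterm C V) : gterm C V :=
  @TApp group_language C V SInv (fun=> t).
Definition tone (C V : Type) : gterm C V :=
  @TApp group_language C V SOne (fun i : 'I_0 => False_rect _ (notF (ltn_ord i))).
Definition tcomm (C V : Type) (t u : gterm C V) : gterm C V :=
  tmul (tinv t) (tmul (tinv u) (tmul t u)).

Lemma generates_tnth (G : groupType) (s : seq G) : gen [set` s] = [set: G] ->
  generates (M := group_structure G) (tnth (in_tuple s)).
Proof.
move=> gs x; have : [set: G] x by []. rewrite -gs.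
pose T := [set x : G | exists t : gterm 'I_(size s) void,
  teval (M := group_structure G) (tnth (in_tuple s)) (of_void _) t = x].
apply: (gen_min (S := T)).
  apply/group_closedP; split=> [|_ _ [t <-] [u <-]|_ [t <-]].
  - by exists (tone _ _).
  - by exists (tmul t u).
  - by exists (tinv t).
by move=> y /(@tnthP _ _ (in_tuple s))[i ->]; exists (TCst i).
Qed.

Lemma generates_gen (G : groupType) (n : nat) (h : 'I_n -> G) :
  generates (M := group_structure G) h ->
  gen [set` [seq h a | a <- enum 'I_n]] = [set: G].
Proof.
move=> gh; apply/seteqP; split=> // x _; have [t <-] := gh x.
have /group_closedP[g1 gM gV] :=
  @group_closed_gen G [set` [seq h a | a <- enum 'I_n]].
elim: t => //= [a|f args IH].
  by apply: sub_gen; apply: (map_f h); rewrite mem_enum.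
by case: f args IH => /= args IH; [apply: gM|apply: gV|].
Qed.

End GroupTerms.

(** * Words whose values are the terms of the lower central series *)

Section Words.
Variables (G : groupType) (n : nat) (h : 'I_n -> G).
Notation gterm := (term group_language).
Notation GS := (group_structure G).

Definition tcomm_prods (V : Type) (s : seq 'I_n) (t : 'I_n -> gterm 'I_n V) :
    gterm 'I_n V :=
  foldr (fun a u => tmul (tcomm (t a) (TCst a)) u) (tone _ _) s.

Lemma teval_tcomm_prods (V : Type) (s : seq 'I_n)
    (t : 'I_n -> gterm 'I_n V) (v : V -> GS) :
  teval (M := GS) h v (tcomm_prods s t) =
  \prod_(a <- s) [~ teval (M := GS) h v (t a) : G, h a].
Proof.
by elim: s => [|a s IH]; rewrite ?big_nil ?big_cons // -IH.
Qed.

Lemma comm_prodsP (A : set G) (s : seq 'I_n) z : uniq s -> A 1 ->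
  comm_prods A (map h s) z <->
  exists2 x : 'I_n -> G, (forall a, A (x a)) & z = \prod_(a <- s) [~ x a, h a].
Proof.
move=> + A1; elim: s z => [|a s IH] z /=.
  by split=> [->|[x _ ->]]; [exists (fun=> 1) => //|]; rewrite big_nil.
move=> /andP[sa us]; split=> [[y [w [Ay /(IH _ us)[x Ax ->] ->]]]|[x Ax ->]].
  exists (fun b => if b == a then y else x b) => [b|]; first by case: eqP.
  rewrite big_cons eqxx; congr (_ * _); apply: eq_big_seq => b sb.
  by case: eqP => // ba; rewrite -ba sb in sa.
exists (x a), (\prod_(b <- s) [~ x b, h b]); rewrite big_cons; split=> //.
by apply/(IH _ us); exists x.
Qed.

(** Each step down the series takes one copy of the previous word, in variables of
    its own, for each generator. *)
Fixpoint word_vars (k : nat) : finType :=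
  if k is k'.+1 then ('I_n * word_vars k')%type else unit.

Fixpoint gamma_word (k : nat) : gterm 'I_n (word_vars k) :=
  if k is k'.+1 then
    tcomm_prods (enum 'I_n) (fun a => rename (pair a) (gamma_word k'))
  else TVar tt.

(** Membership in gamma_(k+1) becomes an equation, by unfolding
    [gammaS_comm_prods] k times. *)
Lemma gamma_wordP c k z : generates (M := GS) h -> gamma G c.+1 = [set 1] ->
  gamma G k.+1 z <->
  exists v : word_vars k -> GS, teval (M := GS) h v (gamma_word k) = z.
Proof.
move=> /generates_gen gh Gc; elim: k z => [|k IH] z.
  by split=> // _; exists (fun=> z).
rewrite (gammaS_comm_prods gh Gc) // comm_prodsP ?enum_uniq //; last exact: gamma1.
split=> [[x Gx ->]|[v <-]] /=.
  have /choice[v vx] : forall a, exists v : word_vars k -> GS,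
      teval (M := GS) h v (gamma_word k) = x a.
    by move=> a; apply/IH.
  exists (fun p => v p.1 p.2); rewrite teval_tcomm_prods; apply: eq_bigr => a _.
  by rewrite teval_rename -vx.
exists (fun a => teval (M := GS) h (v \o pair a) (gamma_word k)) => [a|].
  by apply/IH; exists (v \o pair a).
by rewrite teval_tcomm_prods; apply: eq_bigr => a _; rewrite teval_rename.
Qed.

End Words.

(** * Equations in the quotient and membership in the series *)

Section Quotient.
Variables (G : groupType) (i j : nat).
Notation H := (gamma_quotient G i j).
Notation piH := (\pi_(gamma_quotient G i j)).
Implicit Types x y : gamma_sub G i.

Lemma teval_morph (L : language) (M N : structure L) (phi : M -> N) (C V : Type)
    (cst : C -> M) (v : V -> M) (t : term L C V) :
  (forall (f : Defs.fsym L) args,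
     phi (finterp (f := f) args) = finterp (f := f) (phi \o args)) ->
  phi (teval cst v t) = teval (phi \o cst) (phi \o v) t.
Proof.
move=> phiM; elim: t => //= f args IH; rewrite phiM; congr finterp.
by apply/funext => k; apply: IH.
Qed.

Lemma gamma_piE x y :
  piH x = piH y <-> gamma G j ((val x)^-1 * val y).
Proof. by split=> [/eqmodP/asboolP|?]; last apply/eqmodP/asboolP. Qed.

Lemma gamma_pi1 : piH 1 = 1.
Proof. by rewrite -[RHS]/(gamma_one G i j) /gamma_one -lock. Qed.

Lemma teval_gamma_pi (C V : Type) (cst : C -> gamma_sub G i)
    (v : V -> gamma_sub G i) (t : term group_language C V) :
  teval (M := group_structure H) (piH \o cst) (piH \o v) t =
  piH (teval (M := group_structure (gamma_sub G i)) cst v t).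
Proof.
apply/esym/(teval_morph (M := group_structure (gamma_sub G i))
                        (N := group_structure H)).
case=> args; first exact: pi_gamma_mul; first exact: pi_gamma_inv.
exact: gamma_pi1.
Qed.

Lemma teval_gamma_val (C V : Type) (cst : C -> gamma_sub G i)
    (v : V -> gamma_sub G i) (t : term group_language C V) :
  val (teval (M := group_structure (gamma_sub G i)) cst v t) =
  teval (M := group_structure G) (val \o cst) (val \o v) t.
Proof.
apply: (teval_morph (M := group_structure (gamma_sub G i))
                    (N := group_structure G)).
by case=> args //=; apply: gmulfV.
Qed.

(** The dictionary behind both halves of the theorem: an equation between classes
    is a membership condition on representatives. *)
Lemma teval_gamma_quotient_eq (C V : Type) (cst : C -> gamma_sub G i)
    (v : V -> gamma_sub G i) (l r : term group_language C V) :
  let evH := teval (M := group_structure H) (piH \o cst) (piH \o v) in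
  let evG := teval (M := group_structure G) (val \o cst) (val \o v) in
  evH l = evH r <-> gamma G j ((evG l : G)^-1 * evG r).
Proof. by rewrite /= !teval_gamma_pi -!teval_gamma_val; apply: gamma_piE. Qed.

End Quotient.

Lemma Forall_map_seq (T : eqType) (U : Type) (P : U -> Prop) (f : T -> U) (s : seq T) :
  List.Forall P [seq f x | x <- s] <-> (forall x, x \in s -> P (f x)).
Proof.
elim: s => [|x s IH] /=; first by split.
rewrite List.Forall_cons_iff IH; split=> [[Px Ps] y|Ps].
  by rewrite inE => /predU1P[->|/Ps].
by split=> [|y ys]; apply: Ps; rewrite inE ?eqxx ?ys ?orbT.
Qed.

(** * Interpretation of the quotient *)

Section Definability.
Variables (G : groupType) (c n : nat) (h : 'I_n -> G).
Hypotheses (gen_h : generates (M := group_structure G) h)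
  (Gc : gamma G c.+1 = [set 1]).
Notation GS := (group_structure G).
Notation gterm := (term group_language).

(** The auxiliary variables are the parameters of one word for gamma_(i+1) per
    coordinate, and of one word for gamma_(j+1). *)
Lemma gamma_definable (I : finType) (i j : nat) (t : gterm GS I) :
  e_definable (M := GS)
    [set a : I -> G | (forall p, gamma G i.+1 (a p)) /\
                      gamma G j.+1 (teval (M := GS) id a t)].
Proof.
pose V : finType := ((I * word_vars n i) + word_vars n j)%type.
pose W k (r : word_vars n k -> V) : gterm GS (I + 'I_#|V|) :=
  tsubst (fun a => TCst (h a : GS)) (fun q => TVar (inr (enum_rank (r q))))
    (gamma_word n k).
pose S : system group_language GS (I + 'I_#|V|) :=
  (rename inl t, W j inr) ::
  [seq (TVar (inl p), W i (fun q => inl (p, q))) | p <- enum I].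
have evW k (r : word_vars n k -> V) (a : I -> GS) (y : 'I_#|V| -> GS) :
    teval id (fun x => match x with inl i => a i | inr j => y j end) (W k r) =
    teval (M := GS) h (y \o enum_rank \o r) (gamma_word n k).
  by rewrite teval_tsubst.
exists #|V|, S => a; split=> [[Ga Gt]|[y]].
  have /choice[v va] : forall p, exists v,
      teval (M := GS) h v (gamma_word n i) = a p.
    by move=> p; apply/(gamma_wordP _ _ gen_h Gc).
  have /(gamma_wordP _ _ gen_h Gc)[u ut] := Gt.
  exists (fun k =>
    match enum_val k : V with inl (p, q) => v p q | inr q => u q end).
  apply/List.Forall_cons_iff; split => /=.
    rewrite teval_rename evW -[LHS]ut; apply: (teval_ext (M := GS)) => q /=.
    by rewrite enum_rankK.
  apply/Forall_map_seq => p _ /=; rewrite evW -va.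
  apply: (teval_ext (M := GS)) => q /=.
  by rewrite enum_rankK.
move=> /List.Forall_cons_iff[/= St /Forall_map_seq Sa]; split=> [p|].
  apply/(gamma_wordP _ _ gen_h Gc); exists (y \o enum_rank \o (fun q => inl (p, q))).
  by rewrite -(evW _ _ a) -Sa ?mem_enum.
apply/(gamma_wordP _ _ gen_h Gc); exists (y \o enum_rank \o inr).
by rewrite -(evW _ _ a) -St teval_rename.
Qed.

Variables i j : nat.
Notation H := (gamma_quotient G i.+1 j.+1).
Notation piH := (\pi_(gamma_quotient G i.+1 j.+1)).

Definition gamma_domain : set ('I_1 -> GS) := [set x | gamma G i.+1 (x ord0)].

Definition gamma_class (x : {x : 'I_1 -> GS | gamma_domain x}) : group_structure H :=
  piH (GammaSub (mem_set (proj2_sig x) : _ \in gamma_pred i.+1)).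

Lemma gamma_class_surj a : exists x, gamma_class x = a.
Proof.
elim/quotW: a => -[x Gx]; have Gx' : gamma_domain (fun=> x) by apply/set_mem.
by exists (exist _ _ Gx'); congr (\pi _); apply: val_inj.
Qed.

(** The graphs of the operations and the equality are all solution sets of one
    equation without constants, so this covers every clause of the
    interpretation at once. *)
Lemma equation_preimage_definable m (l r : gterm void 'I_m) :
  e_definable (preimage_rel gamma_class
    [set a | teval (of_void (group_structure H)) a l = teval (of_void _) a r]).
Proof.
pose lift t : gterm GS ('I_m * 'I_1) :=
  tsubst (of_void _) (fun k => TVar (k, ord0)) t.
have evlift (a : 'I_m * 'I_1 -> GS) t :
    teval id a (lift t) = teval (of_void _) (fun k => a (k, ord0)) t.
  by rewrite teval_tsubst; congr teval; apply/funext; case.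
have := gamma_definable i j (tmul (tinv (lift l)) (lift r)).
congr (e_definable _); apply/funext => a; apply/propext.
have key (Ga : forall k, gamma_domain (fun e => a (k, e))) :
    teval (of_void (group_structure H))
      (fun k => gamma_class (exist _ _ (Ga k))) l =
    teval (of_void (group_structure H))
      (fun k => gamma_class (exist _ _ (Ga k))) r <->
    gamma G j.+1 (teval (M := GS) id a (tmul (tinv (lift l)) (lift r))).
  have := teval_gamma_quotient_eq j.+1 (of_void _)
     (fun k => GammaSub (mem_set (Ga k) : _ \in gamma_pred i.+1)) l r.
  have -> : piH \o of_void _ = of_void (group_structure H).
    by apply/funext; case.
  have -> : val \o of_void (gamma_sub G i.+1) = of_void GS.
    by apply/funext; case.
  by rewrite /= !evlift.
split=> [[Ga Gt]|[Ga eq_a]].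
  have Ga' k : gamma_domain (fun e => a (k, e)) by apply: Ga.
  by exists Ga'; apply/key.
split; last exact/key.
by case=> k e; rewrite (ord1 e); apply: Ga.
Qed.

Lemma gamma_quotient_interpretable : e_interpretable (group_structure H) GS.
Proof.
exists 1%N, gamma_domain, gamma_class; split.
- exact: gamma_class_surj.
(* The second condition is void: it says that 1 lies in gamma_1. *)
- have := gamma_definable i 0 (tone GS 'I_1).
  congr e_definable; apply/funext => a; apply/propext; rewrite /gamma_domain /=.
  by split=> [[]|Ga] //; split=> // p; rewrite (ord1 p).
- move=> f; exact: (equation_preimage_definable
    (TApp (L := group_language) f (fun k => TVar (lift ord_max k))) (TVar ord_max)).
- by case.
- exact: (equation_preimage_definable (TVar ord0) (TVar ord_max)).
Qed.

End Definability.

(** * Computable functions on trees *)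

Section Programs.

(** Programs are handled through the functions that they compute, which are
    closed under the constructions used below; the reduction is primitive
    recursive, so total functions suffice. *)
Definition total_computable (f : tree -> tree) := exists p, forall x, runs p x (f x).

Fixpoint tree_rec (b s : tree -> tree) (t x : tree) : tree :=
  if t is Node l r then
    s (Node (Node l r) (Node x (Node (tree_rec b s l x) (tree_rec b s r x))))
  else b x.

Definition tree_if (c t u : tree) : tree := if c is Node _ _ then t else u.

Lemma computable_id : total_computable (fun x => x).
Proof. by exists PId => x; apply: runs_id. Qed.

Lemma computable_node f g : total_computable f -> total_computable g ->
  total_computable (fun x => Node (f x) (g x)).
Proof. by move=> [p fp] [q gq]; exists (PNode p q) => x; apply: runs_node. Qed.

Lemma computable_cst t : total_computable (fun=> t).
Proof.
elim: t => [|l IHl r IHr]; first by exists PLeaf => x; apply: runs_leaf.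
exact: computable_node.
Qed.

Lemma computable_comp f g : total_computable f -> total_computable g ->
  total_computable (fun x => f (g x)).
Proof. by move=> [p fp] [q gq]; exists (PComp p q) => x; apply: runs_comp. Qed.

Lemma computable_left f : total_computable f ->
  total_computable (fun x => left_subtree (f x)).
Proof. by apply: computable_comp; exists PLeft => x; apply: runs_left. Qed.

Lemma computable_right f : total_computable f ->
  total_computable (fun x => right_subtree (f x)).
Proof. by apply: computable_comp; exists PRight => x; apply: runs_right. Qed.

Lemma computable_if c f g : total_computable c -> total_computable f ->
  total_computable g -> total_computable (fun x => tree_if (c x) (f x) (g x)).
Proof.
move=> [r cr] [p fp] [q gq]; exists (PIf r p q) => x; have := cr x.
by case: (c x) => [|u v] rx; [apply: runs_if_leaf | apply: runs_if_node rx _].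
Qed.

Lemma computable_rec b s f g : total_computable b -> total_computable s ->
  total_computable f -> total_computable g ->
  total_computable (fun x => tree_rec b s (f x) (g x)).
Proof.
move=> [p bp] [q sq] cf cg; have [r fgr] := computable_node cf cg.
exists (PComp (PRec p q) r) => x; apply: runs_comp (fgr x) _.
elim: (f x) => [|u IHu v IHv] /=; first exact: runs_rec_leaf.
exact: runs_rec_node IHu IHv _.
Qed.

Lemma computable_table (m : nat) (F : nat -> tree) :
  exists2 f, total_computable f & forall k, (k < m)%N -> f (encode_nat k) = F k.
Proof.
elim: m F => [|m IH] F; first by exists id => //; apply: computable_id.
have [f cf fF] := IH (F \o succn).
exists (fun x => tree_if x (f (right_subtree x)) (F 0%N)).
  apply: computable_if computable_id _ (computable_cst _).
  by apply: computable_comp cf _; apply: computable_right computable_id.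
by case=> //= k; rewrite ltnS => /fF.
Qed.

Lemma computable_affine (a b : nat) :
  exists2 f, total_computable f & forall k, f (encode_nat k) = encode_nat (k * a + b).
Proof.
pose s z := iter a (Node Leaf) (right_subtree (right_subtree (right_subtree z))).
exists (fun x => tree_rec (fun=> encode_nat b) s x Leaf).
  apply: computable_rec computable_id (computable_cst _); first exact: computable_cst.
  rewrite /s; elim: (a) => [|a' IH] /=.
    by do 3!apply: computable_right; apply: computable_id.
  by apply: computable_node IH; apply: computable_cst.
elim=> //= k ->; rewrite /s /= mulSn -addnA; move: (k * a + b)%N => e.
by elim: (a) => //= a' ->.
Qed.

Lemma computable_length : exists2 f, total_computable f
  & forall s, f (encode_seq s) = encode_nat (size s).
Proof.
pose s z := Node Leaf (right_subtree (right_subtree (right_subtree z))).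
exists (fun x => tree_rec (fun=> Leaf) s x Leaf); last by elim=> //= t s' ->.
apply: computable_rec computable_id (computable_cst _); first exact: computable_cst.
apply: computable_node; first exact: computable_cst.
by do 3!apply: computable_right; apply: computable_id.
Qed.

Section TermPrograms.
Variable L : language.

(** The index k of a variable or equation is part of the input here; it selects
    the copy of the variables of t. *)
Lemma computable_rename (n : nat) (U : Type) (r : nat -> U -> nat)
    (t : term L 'I_n U) :
  (forall u, exists2 f, total_computable f
     & forall k, f (encode_nat k) = encode_nat (r k u)) ->
  exists2 f, total_computable f
    & forall k, f (encode_nat k) = encode_term (rename (r k) t).
Proof.
move=> cr; elim: t => [u|a|f args IH].
- have [f cf fr] := cr u.
  exists (fun x => Node (encode_nat 0) (f x)) => [|k]; last by rewrite fr.
  by apply: computable_node cf; apply: computable_cst.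
- exists (fun=> encode_term (TCst a : term L 'I_n nat)) => //.
  exact: computable_cst.
- have [F cF FE] : exists2 F, total_computable F & forall k, F (encode_nat k) =
    encode_seq
      [seq encode_term (rename (r k) (args i)) | i <- enum 'I_(farity f)].
    elim: (enum _) => [|i s [F cF FE]].
      by exists (fun=> Leaf) => //; apply: computable_cst.
    have [F1 cF1 F1E] := IH i; exists (fun x => Node (F1 x) (F x)) => [|k].
      exact: computable_node.
    by rewrite F1E FE.
  exists (fun x =>
    Node (encode_nat 2) (Node (encode_nat (enum_rank f)) (F x))) => [|k].
    by do 2!(apply: computable_node; first exact: computable_cst).
  by rewrite FE.
Qed.

(** Recursion on trees visits all subtrees alike and does not know whether a
    subtree encodes a term or a list of terms.  So it computes a pair: the result
    of reading the tree as a term, and that of reading it as a list.  For an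
    application, the list part at the node holding the function symbol and the
    arguments has the substituted arguments as its tail. *)
Lemma computable_tsubst (m n : nat) (sc : 'I_m -> term L 'I_n nat)
    (sv : nat -> term L 'I_n nat) (fv : tree -> tree) : total_computable fv ->
  (forall k, fv (encode_nat k) = encode_term (sv k)) ->
  exists2 f, total_computable f
    & forall t, f (encode_term t) = encode_term (tsubst sc sv t).
Proof.
move=> cfv fvE.
(* There are finitely many constants, so their images form a finite table. *)
have [fc cfc fcE] := computable_table m
  (fun k => if insub k is Some a then encode_term (sc a) else Leaf).
pose tag z := left_subtree (left_subtree z).
pose body z := right_subtree (left_subtree z).
pose recl z := left_subtree (right_subtree (right_subtree z)).
pose recr z := right_subtree (right_subtree (right_subtree z)).
pose s z := Node
  (tree_if (tag z)
     (tree_if (right_subtree (tag z))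
        (Node (tag z) (Node (left_subtree (body z))
                            (right_subtree (right_subtree (recr z)))))
        (fc (body z)))
     (fv (body z)))
  (Node (left_subtree (recl z)) (right_subtree (recr z))).
pose R t := tree_rec (fun=> Node Leaf Leaf) s t Leaf.
have cs : total_computable s.
  have ctag : total_computable tag.
    by do 2!apply: computable_left; apply: computable_id.
  have cbody : total_computable body.
    by apply: computable_right; apply: computable_left; apply: computable_id.
  have crecl : total_computable recl.
    by apply: computable_left; do 2!apply: computable_right; apply: computable_id.
  have crecr : total_computable recr.
    by do 3!apply: computable_right; apply: computable_id.
  apply: computable_node; last first.
    by apply: computable_node; [apply: computable_left|apply: computable_right].
  apply: computable_if => //; last exact: computable_comp.
  apply: computable_if; [exact: computable_right| |exact: computable_comp].
  apply: computable_node => //; apply: computable_node; first exact: computable_left.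
  by do 2!apply: computable_right.
exists (fun x => left_subtree (R x)).
  apply: computable_left; apply: computable_rec => //; try exact: computable_cst.
  exact: computable_id.
have Rseq u :
    right_subtree (R (encode_seq u)) = encode_seq [seq left_subtree (R x) | x <- u].
  by elim: u => //= x u <-.
elim=> [x|a|f args IH] /=; first exact: fvE.
  rewrite /tag /body /= fcE // insubT // => lt_am.
  by congr (encode_term (sc _)); apply: val_inj.
rewrite /tag /body /recr /= -/(R _) Rseq -map_comp.
congr (Node _ (Node _ (encode_seq _))); apply: eq_map => k /=; apply: IH.
Qed.

End TermPrograms.

Lemma encode_tmul (n : nat) (t u : term group_language 'I_n nat) :
  encode_term (tmul t u) =
  Node (encode_nat 2) (Node (encode_nat (enum_rank SMul))
    (Node (encode_term t) (Node (encode_term u) Leaf))).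
Proof.
rewrite /=; do 2!congr Node.
have -> : enum 'I_2 = [:: ord0; ord_max].
  by apply: (inj_map val_inj); rewrite val_enum_ord.
by [].
Qed.

End Programs.

(** * The reduction of Diophantine problems *)

Section Reduction.
Variables (G : groupType) (c i j m n : nat).
Notation H := (gamma_quotient G i.+1 j.+1).
Notation piH := (\pi_(gamma_quotient G i.+1 j.+1)).
Notation GS := (group_structure G).
Notation HS := (group_structure H).
Notation gterm := (term group_language).
Variables (g : 'I_m -> HS) (h : 'I_n -> GS).
Hypotheses (gen_h : generates (M := GS) h) (Gc : gamma G c.+1 = [set 1]).

(** A new variable belongs to the k-th old variable or to the k-th equation, and
    is a variable of the word for gamma_(i+1) or gamma_(j+1) respectively; both
    kinds share one numbering. *)
Definition param : finType := (word_vars n i + word_vars n j)%type.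

(** The successor keeps the modulus positive even if there are no parameters. *)
Definition param_index (k : nat) (p : param) : nat :=
  k * #|param|.+1 + enum_rank p.

Definition param_value (y : nat -> param -> G) (q : nat) : G :=
  if (insub (q %% #|param|.+1)%N : option 'I_#|param|) is Some p
  then y (q %/ #|param|.+1)%N (enum_val p) else 1.

Lemma param_valueK y k p : param_value y (param_index k p) = y k p.
Proof.
have lt_p : (enum_rank p < #|param|.+1)%N by apply: ltnW (ltn_ord _).
rewrite /param_value /param_index modnMDl divnMDl // modn_small //.
rewrite divn_small // addn0.
by rewrite (valK (enum_rank p)) enum_rankK.
Qed.

Variable (w : 'I_m -> gterm 'I_n void).

Definition reduce_term : gterm 'I_m nat -> gterm 'I_n nat :=
  tsubst (fun a => rename (of_void nat) (w a))
    (fun k => rename (fun q => param_index k (inl q)) (gamma_word n i)).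

Definition reduce_equation (k : nat) (e : gterm 'I_m nat * gterm 'I_m nat) :=
  (reduce_term e.1,
   tmul (reduce_term e.2)
     (rename (fun q => param_index k (inr q)) (gamma_word n j))).

(** An equation is numbered by the length of what follows it, which the recursion
    on the list has at hand. *)
Fixpoint reduce_system (S : system group_language 'I_m nat) :
    system group_language 'I_n nat :=
  if S is e :: S' then reduce_equation (size S') e :: reduce_system S' else [::].

Lemma computable_reduce_system : computable reduce_system.
Proof.
have idxc (p : param) : exists2 f, total_computable f
    & forall k, f (encode_nat k) = encode_nat (param_index k p).
  exact: computable_affine.
have [fv cfv fvE] : exists2 f, total_computable f & forall k, f (encode_nat k) =
    encode_term (rename (fun q => param_index k (inl q)) (gamma_word n i)).
  by apply: (computable_rename (r := fun k q => param_index k (inl q))) => q; apply: idxc.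
have [fj cfj fjE] : exists2 f, total_computable f & forall k, f (encode_nat k) =
    encode_term (rename (fun q => param_index k (inr q)) (gamma_word n j)).
  by apply: (computable_rename (r := fun k q => param_index k (inr q))) => q; apply: idxc.
have [ft cft ftE] := computable_tsubst (fun a => rename (of_void nat) (w a)) cfv fvE.
have [fl cfl flE] := computable_length.
pose lhs z := left_subtree (left_subtree (left_subtree z)).
pose rhs z := right_subtree (left_subtree (left_subtree z)).
pose rest z := right_subtree (left_subtree z).
pose rec z := right_subtree (right_subtree (right_subtree z)).
pose s z := Node
  (Node (ft (lhs z))
     (Node (encode_nat 2) (Node (encode_nat (enum_rank SMul))
       (Node (ft (rhs z)) (Node (fj (fl (rest z))) Leaf)))))
  (rec z).
have cs : total_computable s.
  apply: computable_node; last by do 3!apply: computable_right; apply: computable_id.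
  apply: computable_node.
    by apply: computable_comp cft _; do 3!apply: computable_left; apply: computable_id.
  do 2!(apply: computable_node; first exact: computable_cst).
  apply: computable_node.
    apply: computable_comp cft _; apply: computable_right.
    by do 2!apply: computable_left; apply: computable_id.
  apply: computable_node; last exact: computable_cst.
  apply: computable_comp cfj _; apply: computable_comp cfl _.
  by apply: computable_right; apply: computable_left; apply: computable_id.
have [p pE] : total_computable (fun x => tree_rec (fun=> Leaf) s x Leaf).
  apply: computable_rec => //; try exact: computable_cst.
  exact: computable_id.
exists p => S; have := pE (encode_system S).
suff -> : tree_rec (fun=> Leaf) s (encode_system S) Leaf =
          encode_system (reduce_system S) by [].
elim: S => // e S IH.
have -> : encode_system (reduce_system (e :: S)) =
    Node (Node (encode_term (reduce_equation (size S) e).1)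
               (encode_term (reduce_equation (size S) e).2))
      (encode_system (reduce_system S)) by [].
rewrite -IH encode_tmul -!ftE -fjE.
by rewrite -(size_map (fun e => Node (encode_term e.1) (encode_term e.2))) -flE.
Qed.

Variable (x : 'I_m -> gamma_sub G i.+1).
Hypotheses (gx : forall a, g a = piH (x a))
  (wx : forall a, teval (M := GS) h (of_void _) (w a) = val (x a)).

Lemma teval_reduce_term (u : nat -> GS) (xi : nat -> gamma_sub G i.+1) t :
  (forall k, teval (M := GS) h (fun q => u (param_index k (inl q)))
               (gamma_word n i) = val (xi k)) ->
  teval h u (reduce_term t) = teval (M := GS) (val \o x) (val \o xi) t.
Proof.
move=> uxi; rewrite teval_tsubst; congr (teval (M := GS) _ _ t); apply/funext => a /=.
  by rewrite teval_rename -wx; apply: (teval_ext (M := GS)); case.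
by rewrite teval_rename -uxi.
Qed.

(** Parameters of representatives of a solution, together with the parameters of
    the errors of the equations in gamma_(j+1), solve the reduced system;
    conversely the classes of the values of the words for gamma_(i+1) solve the
    original one. *)
Lemma reduce_systemP S :
  diophantine_problem g S <-> diophantine_problem h (reduce_system S).
Proof.
have gE : g = piH \o x by apply/funext.
split=> [[v]|[u]].
  have /choice[xi xiv] : forall k, exists y : gamma_sub G i.+1, piH y = v k.
    by move=> k; exists (repr (v k)); apply: reprK.
  have -> : v = piH \o xi by apply/funext => k; rewrite /= xiv.
  have /choice[y yxi] : forall k, exists y,
      teval (M := GS) h y (gamma_word n i) = val (xi k).
    by move=> k; apply/(gamma_wordP _ _ gen_h Gc)/set_mem/valP.
  pose u z :=
    param_value (fun k p => match p with inl q => y k q | inr q => z k q end).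
  have uE z t :
      teval h (u z) (reduce_term t) = teval (M := GS) (val \o x) (val \o xi) t.
    apply: teval_reduce_term => k; rewrite -yxi; apply: (teval_ext (M := GS)) => q.
    by rewrite /u param_valueK.
  (* The equations of S only involve the parameters numbered below its length, so
     those of a further equation can be chosen independently. *)
  move=> vS; suff [z /(_ z) zS] : exists z, forall z',
      (forall k, (k < size S)%N -> z' k = z k) -> solves h (u z') (reduce_system S).
    by exists (u z); apply: zS.
  elim: S vS => [_|e S IH /List.Forall_cons_iff[+ /IH[z zS]]].
    by exists (fun _ _ => 1) => z' _; apply: List.Forall_nil.
  rewrite gE => /esym/teval_gamma_quotient_eq/(gamma_wordP _ _ gen_h Gc)[q qE].
  exists (fun k => if k == size S then q else z k) => z' z'E.
  apply/List.Forall_cons_iff; split.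
    rewrite /= !uE teval_rename.
    have -> : u z' \o (fun r => param_index (size S) (inr r)) = q.
      by apply/funext => r; rewrite /= /u param_valueK z'E //= eqxx.
    by rewrite qE mulVKg.
  apply: zS => k kS; rewrite z'E ?ltnS 1?ltnW //.
  by rewrite (negbTE (_ : k != size S)) // neq_ltn kS.
have Gu k : teval (M := GS) h (fun q => u (param_index k (inl q)))
    (gamma_word n i) \in gamma_pred i.+1.
  by apply/mem_set/(gamma_wordP _ _ gen_h Gc); eexists.
pose xi k : gamma_sub G i.+1 := GammaSub (Gu k).
have uE t : teval h u (reduce_term t) = teval (M := GS) (val \o x) (val \o xi) t.
  exact: teval_reduce_term.
move=> uS; exists (piH \o xi).
elim: S uS => [_|e S IH /List.Forall_cons_iff[]]; first exact: List.Forall_nil.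
move=> eE /IH vS; apply/List.Forall_cons_iff; split=> //.
rewrite gE; apply/esym/teval_gamma_quotient_eq; rewrite -!uE eE /= mulKg.
by apply/(gamma_wordP _ _ gen_h Gc); rewrite teval_rename; eexists.
Qed.

End Reduction.

(** * Finite generation of the quotient *)

Lemma finitely_generated_group (G : groupType) :
  fg_group G -> finitely_generated (group_structure G).
Proof.
move=> [s gs]; exists (size s), (tnth (in_tuple s)); exact: generates_tnth.
Qed.

Lemma finitely_generated_gamma_quotient (G : groupType) (c i j : nat) :
  fg_group G -> gamma G c.+1 = [set 1] -> (1 <= i)%N ->
  finitely_generated (group_structure (gamma_quotient G i j)).
Proof.
move=> [s gs] Gc i1; have [r Gr] := gamma_fg gs Gc i1.
pose p : gamma_sub G i -> gamma_quotient G i j := \pi_(gamma_quotient G i j).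
apply: finitely_generated_group; exists [seq p (insubd (1 : gamma_sub G i) y) | y <- r].
set r' := [seq _ | _ <- _]; apply/seteqP; split=> // q _.
have /group_closedP[g1 gM gV] := @group_closed_gen _ [set` r'].
elim/quotW: q => y.
suff: gen [set` r] `<=` [set z | exists2 y, val y = z & gen [set` r'] (p y)].
  rewrite -Gr => /(_ _ (set_mem (valP y)))[y' /val_inj-> //].
apply: gen_min => [|z rz] /=.
  apply/group_closedP; split=> [|_ _ [a <- ra] [b <- rb]|_ [a <- ra]].
  - by exists 1 => //; rewrite /p gamma_pi1.
  - by exists (a * b); rewrite ?valM // /p pi_gamma_mul; apply: gM.
  - by exists a^-1; rewrite ?gmulfV // /p pi_gamma_inv; apply: gV.
exists (insubd 1 z); last by apply: sub_gen; apply: map_f.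
by rewrite insubdK //; apply/mem_set; rewrite Gr; apply: sub_gen.
Qed.

Theorem proposition2p14 (G : groupType) (c i j : nat)
    (fgG : fg_group G)
    (nilG : gamma G c.+1 = [set 1%g]%classic)
    (i_ge1 : (1 <= i)%N) (le_ij : (i <= j)%N) (j_le : (j <= c.+1)%N) :
  e_interpretable (group_structure (gamma_quotient G i j)) (group_structure G) /\
  diophantine_reducible (group_structure (gamma_quotient G i j)) (group_structure G).
Proof.
have fgH := finitely_generated_gamma_quotient j fgG nilG i_ge1.
have fgG' := finitely_generated_group fgG.
case: i i_ge1 le_ij fgH => // i' _; case: j j_le => // j' _ _ fgH; split.
  by have [n [h gh]] := fgG'; exact: (gamma_quotient_interpretable (h := h) gh nilG).
split=> // m n g h _ gh.
have /choice[x xg] : forall a, exists y : gamma_sub G i'.+1,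
    g a = \pi_(gamma_quotient G i'.+1 j'.+1) y.
  by move=> a; exists (repr (g a)); rewrite reprK.
have /choice[w wx] := fun a => gh (val (x a)).
exists (reduce_system i' j' w); split; first exact: computable_reduce_system.
by move=> S; exact: (reduce_systemP gh nilG xg wx S).
Qed.
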